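(* (Cayley's Theorem for gyrogroups) Every gyrogroup $G$ is isomorphic, as a gyrogroup, to a subgyrogroup of the gyrogroup $(\mathrm{Sym}(G),\oplus)$ of permutations of $G$.
   Context: A gyrogroup is a nonempty set $G$ with a binary operation $\oplus$ such that: (G1) there is $0\in G$ with $0\oplus a=a$ for all $a$; (G2) for each $a$ there is $b$ with $b\oplus a=0$; (G3) for all $a,b\in G$ there is an automorphism $\mathrm{gyr}[a,b]$ of $(G,\oplus)$ (a bijection $G\to G$ preserving $\oplus$) with $a\oplus(b\oplus c)=(a\oplus b)\oplus\mathrm{gyr}[a,b]c$ for all $c\in G$; (G4) $\mathrm{gyr}[a,b]=\mathrm{gyr}[a\oplus b,b]$ for all $a,b\in G$. A gyrogroup isomorphism is a bijection between gyrogroups preserving the operations. A nonempty subset $H$ of a gyrogroup $G$ is a subgyrogroup if $H$ is a gyrogroup under the operation inherited from $G$ and, for all $a,b\in H$, the restriction of $\mathrm{gyr}[a,b]$ to $H$ is an automorphism of $H$. The gyrogroup structure on $\mathrm{Sym}(G)$, the set of all permutations of $G$, is as follows. For $a\in G$ let $L_a\colon x\mapsto a\oplus x$, and let $\mathrm{Stab}(0)=\{\rho\in\mathrm{Sym}(G):\rho(0)=0\}$. Every $\sigma\in\mathrm{Sym}(G)$ can be written uniquely as $\sigma=L_a\circ\gamma$ with $a\in G$, $\gamma\in\mathrm{Stab}(0)$. For $\sigma=L_a\circ\gamma$ and $\tau=L_b\circ\delta$ so written, $\sigma\oplus\tau:=L_{a\oplus b}\circ(\gamma\circ\delta)$; with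 this operation $\mathrm{Sym}(G)$ is a gyrogroup. *)

(* Defs.v *)
From mathcomp Require Import all_boot.
From mathcomp Require Import boolp classical_sets.

Set Implicit Arguments.
Unset Strict Implicit.
Unset Printing Implicit Defensive.

Declare Scope gyro_scope.
Delimit Scope gyro_scope with gyro.
Local Open Scope gyro_scope.

Definition automorphism (T : Type) (op : T -> T -> T) (f : T -> T) : Prop :=
  bijective f /\ forall x y, f (op x y) = op (f x) (f y).

(* Both the identity and the gyrations are determined by the operation, so
   carrying them as data is the same as asserting their existence. *)
Record is_gyrogroup (T : Type) (op : T -> T -> T) (e : T)
    (g : T -> T -> T -> T) : Prop := IsGyrogroup {
  gyro_add0 : forall a, op e a = a;
  gyro_addN : forall a, exists b, op b a = e;
  gyro_aut : forall a b, automorphism op (g a b);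
  gyro_addA : forall a b c, op a (op b c) = op (op a b) (g a b c);
  gyro_loop : forall a b, g a b = g (op a b) b
}.

Record gyrogroup : Type := Gyrogroup {
  gcar :> Type;
  gadd : gcar -> gcar -> gcar;
  gzero : gcar;
  gyr : gcar -> gcar -> gcar -> gcar;
  gyrogroupP : is_gyrogroup gadd gzero gyr
}.

Notation "x ⊕ y" := (gadd x y) (at level 50, left associativity) : gyro_scope.
Arguments gzero {g}.

Definition gyro_isomorphic (G K : gyrogroup) : Prop :=
  exists f : G -> K, bijective f /\ forall x y, f (x ⊕ y) = f x ⊕ f y.

Definition gclosed (G : gyrogroup) (H : set G) : Prop :=
  forall x y, H x -> H y -> H (x ⊕ y).

Definition inherited_add (G : gyrogroup) (H : set G) (cl : gclosed H)
    (x y : {z : G | H z}) : {z : G | H z} :=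
  exist _ (proj1_sig x ⊕ proj1_sig y)
          (cl _ _ (proj2_sig x) (proj2_sig y)).

Record subgyrogroup (G : gyrogroup) : Type := Subgyrogroup {
  sg_set : set G;
  sg_nonempty : (sg_set !=set0)%classic;
  sg_closed : gclosed sg_set;
  sg_zero : {z : G | sg_set z};
  sg_gyr : {z : G | sg_set z} -> {z : G | sg_set z} ->
           {z : G | sg_set z} -> {z : G | sg_set z};
  sg_gyrogroupP : is_gyrogroup (inherited_add sg_closed) sg_zero sg_gyr;
  sg_gyr_restr : forall a b : G, sg_set a -> sg_set b ->
    exists r : {z : G | sg_set z} -> {z : G | sg_set z},
      (forall c, proj1_sig (r c) = gyr a b (proj1_sig c)) /\
      automorphism (inherited_add sg_closed) r
}.

Definition gyrogroup_of_sub (G : gyrogroup) (H : subgyrogroup G) : gyrogroup :=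
  Gyrogroup (sg_gyrogroupP H).
Coercion gyrogroup_of_sub : subgyrogroup >-> gyrogroup.

Section GyroTheory.
Variable G : gyrogroup.
Implicit Types a b c : G.

Lemma gadd0 a : gzero ⊕ a = a.
Proof. exact: (gyro_add0 (gyrogroupP G)). Qed.

Lemma gaddA a b c : a ⊕ (b ⊕ c) = (a ⊕ b) ⊕ gyr a b c.
Proof. exact: (gyro_addA (gyrogroupP G)). Qed.

Lemma gadd_inj a : injective (gadd a).
Proof.
move=> b c bc; have [a' a'a] := gyro_addN (gyrogroupP G) a.
have [/bij_inj gI _] := gyro_aut (gyrogroupP G) a' a; apply: gI.
by rewrite -[LHS]gadd0 -[RHS]gadd0 -a'a -!gaddA bc.
Qed.

Lemma gadd_leftK a' a : a' ⊕ a = gzero -> cancel (gadd a) (gadd a').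
Proof.
move=> a'a c; rewrite gaddA a'a gadd0 (gyro_loop (gyrogroupP G)) a'a.
by apply: (@gadd_inj a); rewrite -{1}(gadd0 a) -gaddA gadd0.
Qed.

Lemma gaddr0 a : a ⊕ gzero = a.
Proof.
have [a' a'a] := gyro_addN (gyrogroupP G) a.
by apply: (@gadd_inj a'); rewrite (gadd_leftK a'a) a'a.
Qed.

Lemma gadd_bij a : bijective (gadd a).
Proof.
have [a' a'a] := gyro_addN (gyrogroupP G) a.
have aa' : a ⊕ a' = gzero.
  by apply: (@gadd_inj a'); rewrite (gadd_leftK a'a) gaddr0.
by exists (gadd a'); apply: gadd_leftK.
Qed.

End GyroTheory.

Definition Sym (T : Type) : Type := {s : T -> T | bijective s}.

Definition sym_fun (T : Type) (s : Sym T) : T -> T := proj1_sig s.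
Coercion sym_fun : Sym >-> Funclass.

Definition sym_comp (T : Type) (s t : Sym T) : Sym T :=
  exist _ (s \o t) (bij_comp (proj2_sig s) (proj2_sig t)).

Lemma sym_eqP (T : Type) (s t : Sym T) : s =1 t -> s = t.
Proof.
case: s t => [s sb] [t tb] /= /funext st; move: st sb tb; rewrite /sym_fun /=.
by move=> -> sb tb; rewrite (Prop_irrelevance sb tb).
Qed.

Section SymGyrogroup.
Variable G : gyrogroup.
Implicit Types (a b c : G) (s t r : Sym G).

Definition ltrans a : Sym G := exist _ (gadd a) (gadd_bij a).

Definition stab0 : set (Sym G) := fun r => r gzero = gzero.

Lemma sym_decomp_inj a b r t : stab0 r -> stab0 t ->
  sym_comp (ltrans a) r = sym_comp (ltrans b) t -> a = b /\ r = t.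
Proof.
move=> r0 t0 /(congr1 (@sym_fun G)) /= E.
have ab : a = b by have /= := congr1 (@^~ gzero) E; rewrite r0 t0 !gaddr0.
split=> //; apply: sym_eqP => x; apply: (@gadd_inj G a).
by have /= := congr1 (@^~ x) E; rewrite -ab.
Qed.

Lemma sym_decomp s : exists p : G * Sym G,
  stab0 p.2 /\ s = sym_comp (ltrans p.1) p.2.
Proof.
have [h hK Kh] := gadd_bij (s gzero).
have hb : bijective h by exists (gadd (s gzero)).
exists (s gzero, sym_comp (exist _ h hb) s); split=> /=.
  by rewrite /stab0 /= -[X in h X]gaddr0 hK.
by apply: sym_eqP => x; rewrite /= Kh.
Qed.

Definition sym_split s : G * Sym G := proj1_sig (cid (sym_decomp s)).

Lemma sym_split_stab0 s : stab0 (sym_split s).2.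
Proof. by rewrite /sym_split; case: cid => p []. Qed.

Lemma sym_splitE s : s = sym_comp (ltrans (sym_split s).1) (sym_split s).2.
Proof. by rewrite /sym_split; case: cid => p []. Qed.

Lemma sym_split_comp a r : stab0 r -> sym_split (sym_comp (ltrans a) r) = (a, r).
Proof.
move=> r0; have := sym_splitE (sym_comp (ltrans a) r).
have := sym_split_stab0 (sym_comp (ltrans a) r).
case: sym_split => b t /= t0 E.
by have [-> ->] := sym_decomp_inj r0 t0 E.
Qed.

Definition sym_add s t : Sym G :=
  sym_comp (ltrans ((sym_split s).1 ⊕ (sym_split t).1))
           (sym_comp (sym_split s).2 (sym_split t).2).

Lemma stab0_comp r t : stab0 r -> stab0 t -> stab0 (sym_comp r t).
Proof. by rewrite /stab0 /= => r0 ->. Qed.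

Lemma sym_addE a b r t : stab0 r -> stab0 t ->
  sym_add (sym_comp (ltrans a) r) (sym_comp (ltrans b) t) =
  sym_comp (ltrans (a ⊕ b)) (sym_comp r t).
Proof. by move=> r0 t0; rewrite /sym_add !sym_split_comp. Qed.

Definition sym_id : Sym G := exist _ id (Bijective (frefl _) (frefl _)).

Definition sym_gyr s t r : Sym G :=
  sym_comp (ltrans (gyr (sym_split s).1 (sym_split t).1 (sym_split r).1))
           (sym_split r).2.

Lemma sym_gyrE a b c r t u : stab0 r -> stab0 t -> stab0 u ->
  sym_gyr (sym_comp (ltrans a) r) (sym_comp (ltrans b) t)
    (sym_comp (ltrans c) u) = sym_comp (ltrans (gyr a b c)) u.
Proof. by move=> r0 t0 u0; rewrite /sym_gyr !sym_split_comp. Qed.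

Lemma sym_compA r s t : sym_comp r (sym_comp s t) = sym_comp (sym_comp r s) t.
Proof. exact: sym_eqP. Qed.

Variant sym_split_spec : Sym G -> Prop :=
  SymSplitSpec a r of stab0 r : sym_split_spec (sym_comp (ltrans a) r).

Lemma sym_splitP s : sym_split_spec s.
Proof. rewrite [s]sym_splitE; constructor; exact: sym_split_stab0. Qed.

Lemma sym_is_gyrogroup : is_gyrogroup sym_add sym_id sym_gyr.
Proof.
have idE : sym_id = sym_comp (ltrans gzero) sym_id.
  by apply: sym_eqP => x; rewrite /= gadd0.
have id0 : stab0 sym_id by [].
split.
- move=> s; case: (sym_splitP s) => a r r0; rewrite idE sym_addE // gadd0.
  exact: sym_eqP.
- move=> s; case: (sym_splitP s) => a r r0.
  have [b ba] := gyro_addN (gyrogroupP G) a.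
  have [h hK Kh] := proj2_sig r.
  have hb : bijective h by exists r.
  have h0 : stab0 (exist _ h hb : Sym G).
    by rewrite /stab0 /= -[in h _]r0; apply: hK.
  exists (sym_comp (ltrans b) (exist _ h hb)); rewrite sym_addE // ba [RHS]idE.
  by congr sym_comp; apply: sym_eqP => x /=; apply: hK.
- move=> s t; case: (sym_splitP s) => a r r0; case: (sym_splitP t) => b u u0.
  have [[h hK Kh] gM] := gyro_aut (gyrogroupP G) a b; split.
    exists (fun w => sym_comp (ltrans (h (sym_split w).1)) (sym_split w).2).
      move=> w; case: (sym_splitP w) => c v v0.
      by rewrite sym_gyrE // sym_split_comp //= hK.
    move=> w; case: (sym_splitP w) => c v v0.
    by rewrite sym_split_comp // sym_gyrE //= Kh.
  move=> x y; case: (sym_splitP x) => c v v0; case: (sym_splitP y) => d w w0.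
  have vw0 := stab0_comp v0 w0.
  by rewrite [sym_add (sym_comp _ v) _]sym_addE // !sym_gyrE // sym_addE // gM.
- move=> s t x; case: (sym_splitP s) => a r r0; case: (sym_splitP t) => b u u0.
  case: (sym_splitP x) => c v v0.
  have ru0 := stab0_comp r0 u0; have uv0 := stab0_comp u0 v0.
  rewrite sym_gyrE // [sym_add (sym_comp _ u) _]sym_addE // sym_addE //.
  by rewrite gaddA (sym_compA r) (sym_addE _ _ r0 u0) sym_addE.
- move=> s t; case: (sym_splitP s) => a r r0; case: (sym_splitP t) => b u u0.
  have ru0 := stab0_comp r0 u0.
  apply: funext => x; case: (sym_splitP x) => c v v0.
  by rewrite sym_addE // !sym_gyrE // (gyro_loop (gyrogroupP G)).
Qed.

Definition sym_gyrogroup : gyrogroup := Gyrogroup sym_is_gyrogroup.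

End SymGyrogroup.

(* Main.v *)
Require Import Defs.
From mathcomp Require Import all_boot.
From mathcomp Require Import boolp classical_sets.

Set Implicit Arguments.
Unset Strict Implicit.
Unset Printing Implicit Defensive.

Local Open Scope gyro_scope.

(** The left regular representation [a |-> L_a] embeds [G] in [Sym G]: the
    stabilizer part of [L_a] is the identity, so the decomposition of
    permutations gives [L_a ⊕ L_b = L_(a ⊕ b)], and [L_a] sends [0] to [a],
    so distinct elements yield distinct translations.

    It remains to see that the image of an injective homomorphism
    [f : G -> K] is a subgyrogroup isomorphic to [G].  The gyrogroup axioms
    transport along the bijection from [G] to the image.  The delicate clause
    is that the gyrations of the ambient gyrogroup [K] restrict to
    automorphisms of the image; it holds because left cancellation makes the
    gyrations determined by the operation, so that every homomorphism
    commutes with them ([hom_gyr]); hence [gyr (f a) (f b)] restricted to the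
    image is the transport of [gyr a b], an automorphism of [G]. *)

Lemma gyrogroup_transport (G : gyrogroup) (T : Type) (op : T -> T -> T)
    (h : G -> T) (k : T -> G) :
  cancel h k -> cancel k h -> (forall a b, h (a ⊕ b) = op (h a) (h b)) ->
  is_gyrogroup op (h gzero) (fun x y z => h (gyr (k x) (k y) (k z))).
Proof.
move=> hK kK hD.
have kD x y : k (op x y) = k x ⊕ k y by rewrite -{1}(kK x) -{1}(kK y) -hD hK.
split.
- by move=> x; rewrite -{1}(kK x) -hD gadd0 kK.
- move=> x; have [b bx] := gyro_addN (gyrogroupP G) (k x).
  by exists (h b); rewrite -{1}(kK x) -hD bx.
- move=> x y.
  have [[g gK Kg] gD] := gyro_aut (gyrogroupP G) (k x) (k y); split.
    by exists (fun z => h (g (k z))) => z; rewrite hK ?gK ?Kg kK.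
  by move=> z t; rewrite kD gD hD.
- by move=> x y z; rewrite -[LHS]kK !kD gaddA !hD !kK.
- by move=> x y; apply: funext => z; rewrite kD -(gyro_loop (gyrogroupP G)).
Qed.

(** Both sides are the unique solution [x] of
    [f a ⊕ (f b ⊕ f c) = (f a ⊕ f b) ⊕ x]. *)
Lemma hom_gyr (G K : gyrogroup) (f : G -> K) :
  (forall a b, f (a ⊕ b) = f a ⊕ f b) ->
  forall a b c, f (gyr a b c) = gyr (f a) (f b) (f c).
Proof.
move=> fD a b c; apply: (@gadd_inj K (f a ⊕ f b)).
by rewrite -gaddA -!fD -gaddA.
Qed.

Lemma injective_hom_image (G K : gyrogroup) (f : G -> K) :
  injective f -> (forall a b, f (a ⊕ b) = f a ⊕ f b) ->
  exists H : subgyrogroup K, gyro_isomorphic G H.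
Proof.
move=> f_inj fD; pose S : set K := fun y => exists a, f a = y.
have S_closed : gclosed S.
  by move=> _ _ [a <-] [b <-]; exists (a ⊕ b); rewrite fD.
have Sf a : S (f a) by exists a.
pose h a : {y | S y} := exist _ (f a) (Sf a).
pose k (y : {y | S y}) : G := proj1_sig (cid (proj2_sig y)).
have fk y : f (k y) = proj1_sig y by rewrite /k; case: cid.
have hK : cancel h k by move=> a; apply: f_inj; rewrite fk.
have kK : cancel k h.
  by move=> y; rewrite /h; case: y (fk y) => z Sz /= E; apply: eq_exist.
have hD a b : h (a ⊕ b) = inherited_add S_closed (h a) (h b).
  by apply: eq_exist; rewrite /= fD.
have S_gyro := gyrogroup_transport hK kK hD.
have S0 : (S !=set0)%classic by exists (f gzero).
have S_restr x y : S x -> S y -> exists r : {z | S z} -> {z | S z},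
    (forall c, proj1_sig (r c) = gyr x y (proj1_sig c)) /\
    automorphism (inherited_add S_closed) r.
  move=> [a <-] [b <-]; exists (fun z => h (gyr a b (k z))); split.
    by move=> z; rewrite /= (hom_gyr fD) fk.
  by have := gyro_aut S_gyro (h a) (h b); rewrite !hK.
exists (Subgyrogroup S0 S_gyro S_restr), h.
by split; first exists k.
Qed.

Lemma ltrans_inj (G : gyrogroup) : injective (@ltrans G).
Proof.
move=> a b /(congr1 (fun s : Sym G => s gzero)) /=.
by rewrite !gaddr0.
Qed.

(** A translation is its own decomposition, with the identity as stabilizer
    part. *)
Lemma ltransD (G : gyrogroup) (a b : G) :
  ltrans (a ⊕ b) = sym_add (ltrans a) (ltrans b).
Proof.
have split_ltrans (c : G) : ltrans c = sym_comp (ltrans c) (sym_id G).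
  exact: sym_eqP.
have id0 : stab0 (sym_id G) by [].
rewrite (split_ltrans a) (split_ltrans b) (sym_addE a b id0 id0).
exact: sym_eqP.
Qed.

Theorem corollary3p4 (G : gyrogroup) :
  exists H : subgyrogroup (sym_gyrogroup G), gyro_isomorphic G H.
Proof.
exact: (@injective_hom_image G (sym_gyrogroup G) _ (@ltrans_inj G)
          (@ltransD G)).
Qed.
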